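(* For every complex number $q$ with $|q|<1$, $$\Psi(-q^3,-q)=\sum_{n=0}^\infty \frac{(-1)^nq^{n(n+1)}(-q;q^2)_n}{(q;q^2)_{n+1}(-q^2;q^2)_n}.$$
   Context: Notation: $(a;q)_n=\prod_{j=0}^{n-1}(1-aq^j)$ (so $(a;q)_0=1$); the base may be replaced by a power of $q$. The false theta series is $$\Psi(a,b)=\sum_{n=0}^\infty a^{n(n+1)/2}b^{n(n-1)/2}-\sum_{n=1}^\infty a^{n(n-1)/2}b^{n(n+1)/2}$$ for $|ab|<1$ (with $0^0=1$). *)

(* Defs.v *)
From Stdlib Require Import Reals.
From Coquelicot Require Import Coquelicot.
Open Scope C_scope.

(* The sum of a complex series; a meaningful value only when [ex_series a]. *)
Definition CSeries (a : nat -> C) : C :=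
  iota (T := C_CompleteNormedModule)
    (is_series (K := C_AbsRing) (V := C_NormedModule) a).

(* (a; q)_n *)
Fixpoint qpoch (a q : C) (n : nat) : C :=
  match n with
  | O => 1
  | S m => qpoch a q m * (1 - a * q ^ m)
  end.

(* Subtraction on nat is truncated, but [n * (n - 1)] is still [0] at [n = 0].
   [Cpow] satisfies [0 ^ 0 = 1]. *)
Definition theta_term (a b : C) (n : nat) : C :=
  a ^ (n * (n + 1) / 2) * b ^ (n * (n - 1) / 2).

(* The second sum of the false theta series, over n >= 1, is over
   [theta_term b a (S n)], n >= 0. *)
Definition ex_false_theta (a b : C) : Prop :=
  ex_series (K := C_AbsRing) (V := C_NormedModule)
    (fun n => theta_term a b n) /\
  ex_series (K := C_AbsRing) (V := C_NormedModule)
    (fun n => theta_term b a (S n)).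

Definition false_theta (a b : C) : C :=
  CSeries (fun n => theta_term a b n) - CSeries (fun n => theta_term b a (S n)).

(* Main.v *)
Require Import Defs.
From Stdlib Require Import Reals Lra Lia.
From Coquelicot Require Import Coquelicot.
Open Scope C_scope.

(** The right-hand side is the member k = 0 of a family of series G_k, with terms
    <<(-1)^n q^(n(n+4k+1)) (-q;q^2)_n
        / ((q^(2k+1);q^2)_(n+1) (-q^(2k+2);q^2)_n)>>
    ([shifted_term], [shifted_sum]), which are linked by
    <<G_k = (1 + q^(2k+1)) - q^(4k+3) G_(k+1)>>.
    This recurrence ([shifted_sum_rec]) holds because the n-th term of
    G_k + q^(4k+3) G_(k+1) is a difference h(n) - h(n+1)
    ([shifted_term_telescopes]) with h(n) tending to 0 and
    h(0) = 1 + q^(2k+1).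
    As 3 + 7 + ... + (4k-1) = 2k^2 + k, iterating from k = 0 gives
    <<G_0 = sum_k (-1)^k q^(2k^2+k) (1 + q^(2k+1))>>,
    which is the false theta series with its two sums merged.

    The remainder after K steps is q^(2K^2+K) G_K up to sign.  It tends to 0
    because the terms of all the G_k are dominated by one convergent series
    that does not depend on k ([Cmod_shifted_term_le], [ex_series_majorant]).

    The family comes from the limiting case of Watson's transformation with
    one numerator parameter equal to the base Q:
    <<sum_n (-1)^n Q^(n(n-1)/2) a^n (aQ/bc)_n / ((aQ/b)_n (aQ/c)_n)
      = sum_n (1-aQ^(2n)) (b)_n (c)_n / ((aQ/b)_n (aQ/c)_n)
              (aQ/bc)^n Q^(n(n-1)) a^n>>.
    Dropping the first term on the right replaces (a, b, c) by
    (aQ^2, bQ, cQ); the case needed here is Q = q^2, a = q^2, b = -q^2,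
    c = q, with G_k the k-th left-hand side divided by 1 - q^(2k+1). *)

(** * Complex series *)

Local Notation is_Cseries :=
  (is_series (K := C_AbsRing) (V := C_NormedModule)).
Local Notation ex_Cseries :=
  (ex_series (K := C_AbsRing) (V := C_NormedModule)).

Lemma CSeries_unique (a : nat -> C) (l : C) : is_Cseries a l -> CSeries a = l.
Proof.
  intros Ha. unfold CSeries.
  apply (iota_unique (V := C_CompleteNormedModule)); [|exact Ha].
  intros y Hy.
  exact (@filterlim_locally_unique nat C_AbsRing C_NormedModule eventually _
           _ _ _ Hy Ha).
Qed.

Lemma CSeries_correct (a : nat -> C) : ex_Cseries a -> is_Cseries a (CSeries a).
Proof. intros [l Hl]. rewrite (CSeries_unique a l Hl). exact Hl. Qed.

Lemma ex_Cseries_le (a : nat -> C) (b : nat -> R) :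
  (forall n, Cmod (a n) <= b n)%R -> ex_series b -> ex_Cseries a.
Proof. exact (ex_series_le (V := C_CompleteNormedModule) a b). Qed.

Lemma Cmod_is_series_le (a : nat -> C) (b : nat -> R) (l : C) :
  (forall n, Cmod (a n) <= b n)%R -> ex_series b -> is_Cseries a l ->
  (Cmod l <= Series b)%R.
Proof.
  intros Hab Hb Ha.
  assert (H1 : is_lim_seq (fun n => Cmod (sum_n (G := C_NormedModule) a n))
                 (Cmod l)).
  { exact (filterlim_comp _ _ _ _ _ _ _ _ Ha
             (filterlim_norm (V := C_NormedModule) l)). }
  assert (H2 : is_lim_seq (sum_n b) (Series b)) by exact (Series_correct b Hb).
  refine (is_lim_seq_le _ _ _ _ _ H1 H2).
  intros n. unfold sum_n.
  eapply Rle_trans;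
    [exact (norm_sum_n_m (V := C_NormedModule) a 0 n)|].
  apply sum_n_m_le. exact Hab.
Qed.

Lemma is_Cseries_telescope (h : nat -> C) (b : nat -> R) :
  (forall n, Cmod (h n) <= b n)%R -> is_lim_seq b 0 ->
  is_Cseries (fun n => h n - h (S n)) (h 0%nat).
Proof.
  intros Hh Hb.
  assert (Hlim : filterlim (fun n => h (S n)) eventually
                   (locally (zero : C_NormedModule))).
  { apply (filterlim_norm_zero (V := C_NormedModule)).
    apply (is_lim_seq_le_le (fun _ => 0%R) _ (fun n => b (S n)) 0%R).
    - intros n. split; [apply Cmod_ge_0 | apply Hh].
    - apply is_lim_seq_const.
    - apply is_lim_seq_incr_1 in Hb. exact Hb. }
  unfold is_series.
  apply filterlim_ext with (f := fun n => plus (h 0%nat) (opp (h (S n)))).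
  { intros n. induction n as [|n IH].
    - rewrite sum_O. reflexivity.
    - rewrite sum_Sn, <- IH. change plus with Cplus. change opp with Copp.
      match goal with |- ?a = ?b => change (@eq C a b) end. ring. }
  assert (H : filterlim
    (fun n => plus (h 0%nat : C_NormedModule) (opp (h (S n)))) eventually
    (locally (minus (h 0%nat : C_NormedModule) zero))).
  { eapply filterlim_comp_2;
      [apply filterlim_const | | apply (filterlim_plus (V := C_NormedModule))].
    eapply filterlim_comp;
      [exact Hlim | apply (filterlim_opp (V := C_NormedModule))]. }
  rewrite minus_zero_r in H. exact H.
Qed.

(** * Bounds and shifts for q-Pochhammer symbols *)

Lemma Cmod_lt_1_neq (w : C) : (Cmod w < 1)%R -> 1 - w <> 0.
Proof.
  intros Hw H. replace w with (1 : C) in Hw.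
  - rewrite Cmod_1 in Hw. lra.
  - replace w with (1 - (1 - w)) by ring. rewrite H. ring.
Qed.

Lemma pow_le_1 (x : R) (n : nat) : (0 <= x <= 1)%R -> (0 <= x ^ n <= 1)%R.
Proof.
  intros Hx. split; [apply pow_le; lra|].
  rewrite <- (pow1 n). apply pow_incr. exact Hx.
Qed.

Lemma pow_le_decr (x : R) (m n : nat) :
  (0 <= x <= 1)%R -> (m <= n)%nat -> (x ^ n <= x ^ m)%R.
Proof.
  intros Hx Hmn. replace n with (m + (n - m))%nat by lia. rewrite pow_add.
  pose proof (pow_le_1 x m Hx). pose proof (pow_le_1 x (n - m) Hx). nra.
Qed.

Lemma Cmod_mult_pow_le (a p : C) (n : nat) :
  (Cmod p <= 1)%R -> (Cmod (a * p ^ n) <= Cmod a)%R.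
Proof.
  intros Hp. rewrite Cmod_mult, Cmod_pow.
  pose proof (pow_le_1 (Cmod p) n (conj (Cmod_ge_0 p) Hp)).
  pose proof (Cmod_ge_0 a). nra.
Qed.

Lemma Cmod_qpoch_lower (a p : C) (r : R) (n : nat) :
  (Cmod a <= r < 1)%R -> (Cmod p <= 1)%R ->
  ((1 - r) ^ n <= Cmod (qpoch a p n))%R.
Proof.
  intros Ha Hp. induction n as [|n IH]; simpl.
  - rewrite Cmod_1. lra.
  - rewrite Cmod_mult, (Rmult_comm (1 - r)).
    apply Rmult_le_compat; [apply pow_le; lra | lra | exact IH |].
    pose proof (Cmod_mult_pow_le a p n Hp).
    pose proof (Cmod_triangle (1 - a * p ^ n) (a * p ^ n)) as T.
    replace (1 - a * p ^ n + a * p ^ n) with (1 : C) in T by ring.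
    rewrite Cmod_1 in T. lra.
Qed.

Lemma Cmod_qpoch_upper (a p : C) (n : nat) :
  (Cmod a <= 1)%R -> (Cmod p <= 1)%R -> (Cmod (qpoch a p n) <= 2 ^ n)%R.
Proof.
  intros Ha Hp. induction n as [|n IH]; simpl.
  - rewrite Cmod_1. lra.
  - rewrite Cmod_mult, (Rmult_comm 2).
    apply Rmult_le_compat; try apply Cmod_ge_0; [exact IH|].
    pose proof (Cmod_mult_pow_le a p n Hp).
    pose proof (Cmod_triangle 1 (- (a * p ^ n))) as T.
    rewrite Cmod_opp, Cmod_1 in T. unfold Cminus. lra.
Qed.

Lemma qpoch_neq_0 (a p : C) (n : nat) :
  (Cmod a < 1)%R -> (Cmod p <= 1)%R -> qpoch a p n <> 0.
Proof.
  intros Ha Hp. apply Cmod_gt_0.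
  eapply Rlt_le_trans;
    [|apply (Cmod_qpoch_lower a p (Cmod a) n); [lra | exact Hp]].
  apply pow_lt. lra.
Qed.

Lemma qpoch_shift (a p : C) (n : nat) :
  1 - a <> 0 ->
  qpoch (a * p) p n = qpoch a p n * (1 - a * p ^ n) / (1 - a).
Proof.
  intros Ha. induction n as [|n IH]; simpl.
  - field. exact Ha.
  - rewrite IH. field. exact Ha.
Qed.

(** * The family of series and its recurrence *)

Definition shifted_term (q : C) (k n : nat) : C :=
  (- (1)) ^ n * q ^ (n * (n + 4 * k + 1)) * qpoch (- q) (q ^ 2) n
    / (qpoch (q ^ (2 * k + 1)) (q ^ 2) (n + 1)
       * qpoch (- q ^ (2 * k + 2)) (q ^ 2) n).

(** For the general parameters of the transformation the telescoping factor is
    1 - aQ^n, here at a = q^(4k+2), Q = q^2. *)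
Definition telescoper (q : C) (k n : nat) : C :=
  shifted_term q k n * (1 - q ^ (4 * k + 2 + 2 * n)).

Section Disc.

Variable q : C.
Hypothesis hq : (Cmod q < 1)%R.

Lemma Cmod_pow_S_le (m : nat) : (Cmod (q ^ S m) <= Cmod q)%R.
Proof. rewrite Cpow_S. apply Cmod_mult_pow_le. lra. Qed.

Lemma Cmod_q2 : (Cmod (q ^ 2) <= 1)%R.
Proof. pose proof (Cmod_pow_S_le 1). lra. Qed.

Lemma one_minus_pow_neq_0 (m : nat) : 1 - q ^ S m <> 0.
Proof.
  apply Cmod_lt_1_neq. pose proof (Cmod_pow_S_le m). lra.
Qed.

Lemma one_plus_pow_neq_0 (m : nat) : 1 + q ^ S m <> 0.
Proof.
  replace (1 + q ^ S m) with (1 - (- q ^ S m)) by ring.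
  apply Cmod_lt_1_neq. rewrite Cmod_opp. pose proof (Cmod_pow_S_le m). lra.
Qed.

(** Both neighbours of the k-th term at n are rational multiples of it: the
    shift of k moves one factor at each end of the two denominator products,
    the shift of n adds one factor to each product.  After cancelling the common
    products the claim is an identity in q, q^k and q^n. *)
Lemma shifted_term_telescopes (k n : nat) :
  shifted_term q k n + q ^ (4 * k + 3) * shifted_term q (S k) n
  = telescoper q k n - telescoper q k (S n).
Proof.
  assert (ED : qpoch (q ^ (2 * S k + 1)) (q ^ 2) (n + 1)
    = qpoch (q ^ (2 * k + 1)) (q ^ 2) (n + 1)
      * (1 - q ^ S (2 * k + 2 * n + 2)) / (1 - q ^ S (2 * k))).
  { replace (2 * S k + 1)%nat with (S (2 * k) + 2)%nat by lia.
    replace (S (2 * k + 2 * n + 2)) with (S (2 * k) + 2 * (n + 1))%nat by lia.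
    replace (2 * k + 1)%nat with (S (2 * k)) by lia.
    rewrite !(Cpow_add_r q (S (2 * k))), (Cpow_mult_r q 2).
    apply qpoch_shift, one_minus_pow_neq_0. }
  assert (EE : qpoch (- q ^ (2 * S k + 2)) (q ^ 2) n
    = qpoch (- q ^ (2 * k + 2)) (q ^ 2) n
      * (1 + q ^ S (2 * k + 2 * n + 1)) / (1 + q ^ S (2 * k + 1))).
  { replace (2 * S k + 2)%nat with (S (2 * k + 1) + 2)%nat by lia.
    replace (S (2 * k + 2 * n + 1)) with (S (2 * k + 1) + 2 * n)%nat by lia.
    replace (2 * k + 2)%nat with (S (2 * k + 1)) by lia.
    rewrite !(Cpow_add_r q (S (2 * k + 1))), (Cpow_mult_r q 2).
    replace (- (q ^ S (2 * k + 1) * q ^ 2))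
      with (- q ^ S (2 * k + 1) * q ^ 2) by ring.
    assert (Ha : 1 - - q ^ S (2 * k + 1) = 1 + q ^ S (2 * k + 1)) by ring.
    rewrite qpoch_shift, Ha by (rewrite Ha; apply one_plus_pow_neq_0).
    unfold Cdiv. ring. }
  unfold telescoper, shifted_term. rewrite ED, EE. clear ED EE.
  replace (S n + 1)%nat with (S (n + 1)) by lia.
  cbn [qpoch].
  assert (HD : qpoch (q ^ (2 * k + 1)) (q ^ 2) (n + 1) <> 0).
  { apply qpoch_neq_0; [|exact Cmod_q2].
    replace (2 * k + 1)%nat with (S (2 * k)) by lia.
    pose proof (Cmod_pow_S_le (2 * k)). lra. }
  assert (HE : qpoch (- q ^ (2 * k + 2)) (q ^ 2) n <> 0).
  { apply qpoch_neq_0; [|exact Cmod_q2].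
    rewrite Cmod_opp. replace (2 * k + 2)%nat with (S (2 * k + 1)) by lia.
    pose proof (Cmod_pow_S_le (2 * k + 1)). lra. }
  generalize dependent (qpoch (q ^ (2 * k + 1)) (q ^ 2) (n + 1)).
  generalize dependent (qpoch (- q ^ (2 * k + 2)) (q ^ 2) n).
  intros E HE D HD.
  generalize (qpoch (- q) (q ^ 2) n). intros P.
  pose proof (one_minus_pow_neq_0 (2 * k)) as N1.
  pose proof (one_minus_pow_neq_0 (2 * k + 2 * n + 2)) as N2.
  pose proof (one_plus_pow_neq_0 (2 * k + 1)) as N3.
  pose proof (one_plus_pow_neq_0 (2 * k + 2 * n + 1)) as N4.
  (* All exponents become sums of Z = n(n+4k+1), n, k and constants, so that
     only the values of q^Z, q^n and q^k remain. *)
  replace (n * (n + 4 * S k + 1))%nat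
    with (n * (n + 4 * k + 1) + n + n + n + n)%nat by lia.
  replace (S n * (S n + 4 * k + 1))%nat
    with (n * (n + 4 * k + 1) + n + n + k + k + k + k + 2)%nat by lia.
  rewrite <- !(Cpow_mult_r q 2).
  generalize dependent (n * (n + 4 * k + 1))%nat. intros Z.
  replace (2 * k)%nat with (k + k)%nat in * by lia.
  replace (2 * n)%nat with (n + n)%nat in * by lia.
  replace (2 * (n + 1))%nat with (n + n + 2)%nat in * by lia.
  replace (2 * S n)%nat with (n + n + 2)%nat in * by lia.
  replace (4 * k)%nat with (k + k + k + k)%nat in * by lia.
  rewrite ?Cpow_S, ?Cpow_add_r in *.
  generalize dependent (q ^ Z). intros z.
  generalize dependent (q ^ k). generalize dependent (q ^ n).
  intros x y N1 N2 N3 N4.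
  generalize ((- (1)) ^ n). intros s.
  simpl Cpow in *.
  field.
  repeat split; try assumption; intros F;
    [apply N4 | apply N2 | apply N3]; rewrite <- F; ring.
Qed.

Lemma telescoper_0 (k : nat) : telescoper q k 0 = 1 + q ^ (2 * k + 1).
Proof.
  unfold telescoper, shifted_term.
  replace (2 * k + 1)%nat with (S (2 * k)) by lia.
  replace (4 * k + 2 + 2 * 0)%nat with (S (2 * k) + S (2 * k))%nat by lia.
  rewrite (Cpow_add_r q (S (2 * k)) (S (2 * k))).
  change (0 + 1)%nat with 1%nat. change (0 * (0 + 4 * k + 1))%nat with 0%nat.
  cbn [qpoch].
  pose proof (one_minus_pow_neq_0 (2 * k)) as N.
  generalize dependent (q ^ S (2 * k)). intros y N.
  cbn [Cpow]. field. replace (y * 1) with y by ring. exact N.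
Qed.

(** * A bound uniform in k *)

(** The numerator product is at most 2^n and every denominator factor is at
    least 1 - |q|.  The quadratic exponent n^2 beats these geometric factors;
    its base is (1 + |q|)/2 instead of |q| so that it stays nonzero at q = 0
    and the ratio test applies. *)
Definition majorant (n : nat) : R :=
  (((1 + Cmod q) / 2) ^ (n * n) * (2 / (1 - Cmod q) ^ 2) ^ n
   / (1 - Cmod q))%R.

Lemma Cmod_shifted_term_le (k n : nat) :
  (Cmod (shifted_term q k n) <= majorant n)%R.
Proof.
  unfold shifted_term, majorant.
  pose proof (Cmod_ge_0 q) as H0.
  pose proof Cmod_q2 as H2.
  assert (HD : ((1 - Cmod q) ^ (n + 1)
                <= Cmod (qpoch (q ^ (2 * k + 1)) (q ^ 2) (n + 1)))%R).
  { apply Cmod_qpoch_lower; [|exact H2]. split; [|exact hq].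
    rewrite Nat.add_1_r. apply Cmod_pow_S_le. }
  assert (HE : ((1 - Cmod q) ^ n
                <= Cmod (qpoch (- q ^ (2 * k + 2)) (q ^ 2) n))%R).
  { apply Cmod_qpoch_lower; [|exact H2]. split; [|exact hq].
    rewrite Cmod_opp. replace (2 * k + 2)%nat with (S (2 * k + 1)) by lia.
    apply Cmod_pow_S_le. }
  assert (HP : (Cmod (qpoch (- q) (q ^ 2) n) <= 2 ^ n)%R).
  { apply Cmod_qpoch_upper; [rewrite Cmod_opp; lra | exact H2]. }
  assert (HQ : (Cmod q ^ (n * (n + 4 * k + 1))
                <= ((1 + Cmod q) / 2) ^ (n * n))%R).
  { eapply Rle_trans; [apply (pow_le_decr _ (n * n)); [lra | nia]|].
    apply pow_incr. lra. }
  assert (p1 : (0 < (1 - Cmod q) ^ (n + 1))%R) by (apply pow_lt; lra).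
  assert (p2 : (0 < (1 - Cmod q) ^ n)%R) by (apply pow_lt; lra).
  rewrite Cmod_div.
  2:{ apply Cmod_gt_0. rewrite Cmod_mult. apply Rmult_lt_0_compat; lra. }
  rewrite !Cmod_mult, !Cmod_pow, Cmod_m1, pow1, Rmult_1_l.
  replace (((1 + Cmod q) / 2) ^ (n * n) * (2 / (1 - Cmod q) ^ 2) ^ n
           / (1 - Cmod q))%R
    with (((1 + Cmod q) / 2) ^ (n * n) * 2 ^ n
          / ((1 - Cmod q) ^ (n + 1) * (1 - Cmod q) ^ n))%R.
  2:{ unfold Rdiv. rewrite (Rpow_mult_distr 2), pow_inv, <- pow_mult.
      replace (2 * n)%nat with (n + n)%nat by lia.
      rewrite !pow_add, pow_1. field. lra. }
  unfold Rdiv at 1 3. apply Rmult_le_compat.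
  - apply Rmult_le_pos; [apply pow_le|]; apply Cmod_ge_0.
  - apply Rlt_le, Rinv_0_lt_compat, Rmult_lt_0_compat; lra.
  - apply Rmult_le_compat;
      [apply pow_le, Cmod_ge_0 | apply Cmod_ge_0 | exact HQ | exact HP].
  - apply Rinv_le_contravar; [apply Rmult_lt_0_compat; lra|].
    apply Rmult_le_compat; lra.
Qed.

Lemma ex_series_majorant : ex_series majorant.
Proof.
  pose proof (Cmod_ge_0 q) as H0.
  set (rho := ((1 + Cmod q) / 2)%R).
  set (x := (2 / (1 - Cmod q) ^ 2)%R).
  assert (Hrho : (0 < rho < 1)%R) by (unfold rho; lra).
  assert (Hx : (0 < x)%R).
  { unfold x. apply Rdiv_lt_0_compat; [lra | apply pow_lt; lra]. }
  assert (Hpos : forall n, (0 < majorant n)%R).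
  { intros n. apply Rdiv_lt_0_compat; [|lra].
    apply Rmult_lt_0_compat; apply pow_lt; fold rho x; lra. }
  apply ex_series_Rabs, (ex_series_DAlembert _ 0); [lra | |].
  - intros n. apply Rgt_not_eq, Hpos.
  - apply is_lim_seq_ext with (u := fun n => ((rho * x) * (rho ^ 2) ^ n)%R).
    + intros n. rewrite Rabs_pos_eq.
      2:{ apply Rlt_le, Rdiv_lt_0_compat; apply Hpos. }
      unfold majorant. fold rho x.
      replace (S n * S n)%nat with (n * n + 2 * n + 1)%nat by lia.
      rewrite !pow_add, (pow_mult rho 2), pow_1. change (x ^ S n)%R with (x * x ^ n)%R.
      field. repeat split; try lra; apply pow_nonzero; lra.
    + replace 0%R with (rho * x * 0)%R at 1 by ring.
      apply (is_lim_seq_scal_l _ (rho * x) 0%R).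
      apply is_lim_seq_geom. rewrite Rabs_pos_eq; nra.
Qed.

Lemma is_lim_seq_majorant : is_lim_seq majorant 0.
Proof. apply ex_series_lim_0, ex_series_majorant. Qed.

Definition shifted_sum (k : nat) : C := CSeries (shifted_term q k).

Lemma is_series_shifted_term (k : nat) :
  is_Cseries (shifted_term q k) (shifted_sum k).
Proof.
  apply CSeries_correct, (ex_Cseries_le _ majorant).
  - apply Cmod_shifted_term_le.
  - apply ex_series_majorant.
Qed.

Lemma Cmod_shifted_sum_le (k : nat) :
  (Cmod (shifted_sum k) <= Series majorant)%R.
Proof.
  apply (Cmod_is_series_le (shifted_term q k)).
  - apply Cmod_shifted_term_le.
  - apply ex_series_majorant.
  - apply is_series_shifted_term.
Qed.

Lemma shifted_sum_rec (k : nat) :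
  shifted_sum k + q ^ (4 * k + 3) * shifted_sum (S k) = 1 + q ^ (2 * k + 1).
Proof.
  rewrite <- telescoper_0.
  assert (H1 : is_Cseries
    (fun n => shifted_term q k n + q ^ (4 * k + 3) * shifted_term q (S k) n)
    (shifted_sum k + q ^ (4 * k + 3) * shifted_sum (S k))).
  { apply (is_series_plus (V := C_NormedModule));
      [apply is_series_shifted_term|].
    apply (is_series_scal (V := C_NormedModule)), is_series_shifted_term. }
  assert (H2 : is_Cseries
    (fun n => telescoper q k n - telescoper q k (S n)) (telescoper q k 0)).
  { apply is_Cseries_telescope with (b := fun n => (2 * majorant n)%R).
    - intros n. unfold telescoper. rewrite Cmod_mult, (Rmult_comm 2).
      apply Rmult_le_compat; try apply Cmod_ge_0;
        [apply Cmod_shifted_term_le|].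
      replace (4 * k + 2 + 2 * n)%nat with (S (4 * k + 1 + 2 * n)) by lia.
      pose proof (Cmod_pow_S_le (4 * k + 1 + 2 * n)).
      pose proof (Cmod_triangle 1 (- q ^ S (4 * k + 1 + 2 * n))) as T.
      rewrite Cmod_opp, Cmod_1 in T. unfold Cminus. lra.
    - replace 0%R with (2 * 0)%R at 1 by ring.
      apply (is_lim_seq_scal_l _ 2 0%R), is_lim_seq_majorant. }
  rewrite <- (CSeries_unique _ _ H2). symmetry. apply CSeries_unique.
  exact (is_series_ext _ _ _ (shifted_term_telescopes k) H1).
Qed.

(** * Iterating the recurrence *)

(** With E_k = (-1)^k q^(2k^2+k) G_k, the recurrence says that the k-th term is
    E_k - E_(k+1), and E_k tends to 0 because G_k is bounded in k. *)
Lemma is_series_sparse_theta :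
  is_Cseries (fun k => (- (1)) ^ k * q ^ (2 * k * k + k) * (1 + q ^ (2 * k + 1)))
    (shifted_sum 0).
Proof.
  pose (E := fun k => (- (1)) ^ k * q ^ (2 * k * k + k) * shifted_sum k).
  replace (shifted_sum 0) with (E 0%nat) by (unfold E; simpl; ring).
  apply is_series_ext with (a := fun k => E k - E (S k)).
  { intros k. unfold E. rewrite <- shifted_sum_rec.
    replace (2 * S k * S k + S k)%nat with (2 * k * k + k + (4 * k + 3))%nat
      by lia.
    rewrite (Cpow_add_r q (2 * k * k + k)), Cpow_S.
    match goal with |- ?a = ?b => change (@eq C a b) end. ring. }
  pose proof (Cmod_ge_0 q) as H0.
  apply is_Cseries_telescope
    with (b := fun k => (Series majorant * Cmod q ^ k)%R).
  - intros k. unfold E.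
    rewrite !Cmod_mult, !Cmod_pow, Cmod_m1, pow1, Rmult_1_l, Rmult_comm.
    apply Rmult_le_compat; [apply Cmod_ge_0 | apply pow_le; lra | |].
    + apply Cmod_shifted_sum_le.
    + apply pow_le_decr; [lra | nia].
  - replace 0%R with (Series majorant * 0)%R at 1 by ring.
    apply (is_lim_seq_scal_l _ (Series majorant) 0%R), is_lim_seq_geom.
    rewrite Rabs_pos_eq; lra.
Qed.

Lemma ex_series_sparse_power (u : nat -> C) (e : nat -> nat) :
  (forall n, u n = (- (1)) ^ n * q ^ e n) -> (forall n, n <= e n)%nat ->
  ex_Cseries u.
Proof.
  intros Hu He. pose proof (Cmod_ge_0 q) as H0.
  apply (ex_Cseries_le _ (fun n => Cmod q ^ n)%R).
  - intros n. rewrite Hu, Cmod_mult, !Cmod_pow, Cmod_m1, pow1, Rmult_1_l.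
    apply pow_le_decr; [lra | apply He].
  - apply ex_series_geom. rewrite Rabs_pos_eq; lra.
Qed.

End Disc.

(** * The two halves of the false theta series *)

Lemma Cpow_opp (x : C) (n : nat) : (- x) ^ n = (- (1)) ^ n * x ^ n.
Proof. rewrite <- Cpow_mult_l. f_equal. ring. Qed.

Lemma Cpow_m1_even (n : nat) : (- (1)) ^ (2 * n) = 1.
Proof.
  rewrite Cpow_mult_r.
  replace ((- (1)) ^ 2) with (1 : C) by (simpl; ring). apply Cpow_1_l.
Qed.

(** Writing both exponents of a theta term through one t = n(n+1)/2 leaves no
    division, so that the comparison of exponents is polynomial. *)
Lemma triangular_even (n : nat) :
  exists t, (S n * n / 2 = t /\ S n * S (S n) / 2 = t + S n
             /\ 2 * t = n * n + n)%nat.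
Proof.
  assert (H : exists t, (n * n + n = 2 * t)%nat).
  { induction n as [|n [t Ht]]; [exists 0%nat; lia|].
    exists (t + S n)%nat. lia. }
  destruct H as [t Ht]. exists t. repeat split; [| |lia].
  - replace (S n * n)%nat with (t * 2)%nat by lia. apply Nat.div_mul. lia.
  - replace (S n * S (S n))%nat with ((t + S n) * 2)%nat by lia.
    apply Nat.div_mul. lia.
Qed.

Lemma theta_term_q3_q (q : C) (n : nat) :
  theta_term (- q ^ 3) (- q) n = (- (1)) ^ n * q ^ (2 * n * n + n).
Proof.
  destruct n as [|n]; [reflexivity|].
  destruct (triangular_even n) as (t & E1 & E2 & Et). unfold theta_term.
  rewrite Nat.add_1_r. replace (S n - 1)%nat with n by lia. rewrite E1, E2.
  rewrite (Cpow_opp (q ^ 3)), (Cpow_opp q t), <- Cpow_mult_r.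
  replace (2 * S n * S n + S n)%nat with (3 * (t + S n) + t)%nat by nia.
  rewrite (Cpow_add_r q (3 * _)), (Cpow_add_r _ t (S n)).
  (* The signs combine to (-1)^(2t + n + 1). *)
  transitivity ((- (1)) ^ (2 * t)
                * ((- (1)) ^ S n * (q ^ (3 * (t + S n)) * q ^ t))).
  - replace (2 * t)%nat with (t + t)%nat by lia.
    rewrite (Cpow_add_r _ t t). ring.
  - rewrite Cpow_m1_even. ring.
Qed.

Lemma theta_term_q_q3 (q : C) (n : nat) :
  theta_term (- q) (- q ^ 3) (S n)
  = - ((- (1)) ^ n * q ^ (2 * n * n + 3 * n + 1)).
Proof.
  destruct (triangular_even n) as (t & E1 & E2 & Et). unfold theta_term.
  rewrite Nat.add_1_r. replace (S n - 1)%nat with n by lia. rewrite E1, E2.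
  rewrite (Cpow_opp (q ^ 3)), (Cpow_opp q (t + _)), <- Cpow_mult_r.
  replace (2 * n * n + 3 * n + 1)%nat with ((t + S n) + 3 * t)%nat by nia.
  rewrite (Cpow_add_r q _ (3 * t)), (Cpow_add_r (- (1)) t (S n)), Cpow_S.
  (* The signs combine to (-1)^(2t + n + 1). *)
  transitivity (- ((- (1)) ^ (2 * t)
                   * ((- (1)) ^ n * (q ^ (t + S n) * q ^ (3 * t))))).
  - replace (2 * t)%nat with (t + t)%nat by lia.
    rewrite (Cpow_add_r _ t t). ring.
  - rewrite Cpow_m1_even. ring.
Qed.

Theorem mainTheorem10 (q : C) (hq : (Cmod q < 1)%R) :
  let rhs (n : nat) : C :=
    (- (1)) ^ n * q ^ (n * (n + 1)) * qpoch (- q) (q ^ 2) n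
      / (qpoch q (q ^ 2) (n + 1) * qpoch (- q ^ 2) (q ^ 2) n) in
  ex_false_theta (- q ^ 3) (- q) /\
  ex_series (K := C_AbsRing) (V := C_NormedModule) rhs /\
  false_theta (- q ^ 3) (- q) = CSeries rhs.
Proof.
  intros rhs.
  assert (Hrhs : is_Cseries rhs (shifted_sum q 0)).
  { apply is_series_ext with (a := shifted_term q 0);
      [|exact (is_series_shifted_term q hq 0)].
    intros n. unfold shifted_term, rhs.
    replace (n + 4 * 0 + 1)%nat with (n + 1)%nat by lia.
    replace (q ^ (2 * 0 + 1)) with q by (simpl; ring). reflexivity. }
  assert (Hpos : ex_Cseries (theta_term (- q ^ 3) (- q))).
  { apply (ex_series_sparse_power q hq _ (fun n => 2 * n * n + n)%nat);
      [apply theta_term_q3_q | intros n; lia]. }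
  assert (Hneg : ex_Cseries (fun n => theta_term (- q) (- q ^ 3) (S n))).
  { apply (ex_series_ext (V := C_NormedModule)
             (fun n => opp ((- (1)) ^ n * q ^ (2 * n * n + 3 * n + 1)))).
    - intros n. symmetry. apply theta_term_q_q3.
    - apply (ex_series_opp (V := C_NormedModule)).
      apply (ex_series_sparse_power q hq _
               (fun n => 2 * n * n + 3 * n + 1)%nat);
        [reflexivity | intros n; lia]. }
  split; [split; [exact Hpos | exact Hneg]|].
  split; [exists (shifted_sum q 0); exact Hrhs|].
  rewrite (CSeries_unique _ _ Hrhs).
  rewrite <- (CSeries_unique _ _ (is_series_sparse_theta q hq)).
  symmetry. apply CSeries_unique.
  eapply is_series_ext;
    [|exact (is_series_minus (V := C_NormedModule) _ _ _ _
               (CSeries_correct _ Hpos) (CSeries_correct _ Hneg))].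
  intros n. cbv beta. rewrite theta_term_q3_q, theta_term_q_q3.
  replace (2 * n * n + 3 * n + 1)%nat
    with ((2 * n * n + n) + (2 * n + 1))%nat by lia.
  rewrite (Cpow_add_r q (2 * n * n + n)).
  change plus with Cplus. change opp with Copp.
  match goal with |- ?a = ?b => change (@eq C a b) end. ring.
Qed.
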